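(* Let $\mathcal{F}$ be a divisible right Oka family in a ring $R$ such that every nonempty chain (with respect to inclusion) of right ideals in $\mathcal{F}'$ has an upper bound in $\mathcal{F}'$, where $\mathcal{F}'$ is the set of right ideals of $R$ not belonging to $\mathcal{F}$. Let $\mathcal{S}$ denote the set of comonoform right ideals of $R$. (1) Let $\mathcal{F}_0$ be a semifilter of right ideals in $R$. If $\mathcal{S}\cap\mathcal{F}_0\subseteq\mathcal{F}$, then $\mathcal{F}_0\subseteq\mathcal{F}$. (2) For a right ideal $J$ of $R$, if all right ideals in $\mathcal{S}$ containing $J$ (respectively, properly containing $J$) belong to $\mathcal{F}$, then all right ideals of $R$ containing $J$ (respectively, properly containing $J$) belong to $\mathcal{F}$. (3) If $\mathcal{S}\subseteq\mathcal{F}$, then $\mathcal{F}$ consists of all right ideals of $R$.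
   Context: Rings are associative with $1$, modules are unital. For an element $m$ and a submodule $N$ of a right $R$-module $M$, put $m^{-1}N:=\{r\in R: mr\in N\}$; in particular $a^{-1}I=\{r\in R: ar\in I\}$ for a right ideal $I$ and $a\in R$. A right Oka family in $R$ is a family $\mathcal{F}$ of right ideals of $R$ with $R\in\mathcal{F}$ such that for every right ideal $I$ and every $a\in R$: if $I+aR\in\mathcal{F}$ and $a^{-1}I\in\mathcal{F}$, then $I\in\mathcal{F}$. A family $\mathcal{F}$ of right ideals is divisible if for all $a\in R$, $I\in\mathcal{F}$ implies $a^{-1}I\in\mathcal{F}$. A semifilter of right ideals in $R$ is a family $\mathcal{F}_0$ of right ideals such that for all right ideals $I,J$ of $R$, if $I\in\mathcal{F}_0$ and $J\supseteq I$ then $J\in\mathcal{F}_0$. A submodule $N\subseteq M$ is dense in $M$ if for all $x,y\in M$ with $x\neq 0$, $x\cdot(y^{-1}N)\neq 0$. A nonzero right module $M$ is monoform if every nonzero submodule of $M$ is dense in $M$ (equivalently, for every submodule $C\subseteq M$, every nonzero homomorphism $C\to M$ is injective). A right ideal $P\subsetneq R$ is comonoform if the right module $R/P$ is monoform. *)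

(* Defs.v *)
From HB Require Import structures.
From mathcomp Require Import all_boot all_algebra.
From mathcomp Require Import boolp classical_sets.

Set Implicit Arguments.
Unset Strict Implicit.
Unset Printing Implicit Defensive.

Import GRing.Theory.
Local Open Scope ring_scope.
Local Open Scope quotient_scope.
Local Open Scope classical_set_scope.

(* Right R-modules are left modules over the converse ring R^c, so that mr is
   (r : R^c) *: m.  Submodules are the boolean predicates of type
   submodClosed; by classical choice (boolp) every subset of a module is a
   boolean predicate, so this is no decidability restriction.  R is a
   pzRingType: the zero ring is allowed. *)
Notation rmodType R := (lmodType (GRing.converse R)).

Definition mulmr (R : pzRingType) (M : rmodType R) (m : M) (r : R) : M :=
  (r : R^c) *: m.

(* The right regular module R_R, whose submodules are the right ideals. *)
Notation regmod R := ((GRing.converse R)^o).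
Notation rightIdeal R := (submodClosed (regmod R)).

Lemma regmodE (R : pzRingType) (a : regmod R) (r : R) :
  mulmr a r = (a : R) * r.
Proof. by []. Qed.

Lemma submod_ext (R : pzRingType) (M : lmodType R) (N1 N2 : submodClosed M) :
  N1 =i N2 -> N1 = N2.
Proof.
case: N1 N2 => [p1 [[h1] [k1]]] [p2 [[h2] [k2]]] e.
have E : p1 = p2 by apply: funext => x; exact: (e x).
case: p2 / E h2 k2 e => h2 k2 _.
by rewrite (Prop_irrelevance h1 h2) (Prop_irrelevance k1 k2).
Qed.

Lemma submod_of_set (R : pzRingType) (M : lmodType R) (A : set M) :
  A 0 -> (forall r x y, A x -> A y -> A (r *: x + y)) ->
  exists N : submodClosed M, forall x, x \in N <-> A x.
Proof.
move=> A0 AL; pose p : {pred M} := fun x => `[< A x >].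
have pc : GRing.submod_closed p.
  by split=> [|r x y /asboolP Ax /asboolP Ay]; apply/asboolP; [|exact: AL].
pose S := GRing.isSubSemiModClosed.Build R M p (GRing.submod_closed_semi pc).
pose N : submodClosed M := HB.pack p S.
by exists N => x; split=> /asboolP.
Qed.

Section Submodules.
Variables (R : pzRingType) (M : rmodType R).
Implicit Types (N : submodClosed M) (m : M).

Definition residual_pred N m : {pred regmod R} := fun r => mulmr m r \in N.

Fact residual_closed N m : GRing.submod_closed (residual_pred N m).
Proof.
have E r : (r \in residual_pred N m) = (mulmr m r \in N) by [].
split=> [|a u v]; rewrite !E /mulmr; first by rewrite scale0r rpred0.
by move=> mu mv; rewrite scalerDl -scalerA rpredD // rpredZ.
Qed.

HB.instance Definition _ N m :=
  GRing.isSubSemiModClosed.Build R^c (regmod R) (residual_pred N m)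
    (GRing.submod_closed_semi (residual_closed N m)).

(* m^{-1}N *)
Definition residual N m : rightIdeal R := residual_pred N m.

Definition whole_pred : {pred M} := predT.

Fact whole_closed : GRing.submod_closed whole_pred.
Proof. by split. Qed.

HB.instance Definition _ :=
  GRing.isSubSemiModClosed.Build R^c M whole_pred
    (GRing.submod_closed_semi whole_closed).

Definition whole : submodClosed M := whole_pred.

(* mR *)
Definition cyclic_pred m : {pred M} := fun x => `[< exists r : R, x = mulmr m r >].

Fact cyclic_closed m : GRing.submod_closed (cyclic_pred m).
Proof.
split=> [|a u v]; first by apply/asboolP; exists 0; rewrite /mulmr scale0r.
move=> /asboolP[r ->] /asboolP[s ->]; apply/asboolP.
by exists (r * a + s); rewrite /mulmr [RHS](scalerDl m (r * a : R^c) s) scalerA.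
Qed.

HB.instance Definition _ m :=
  GRing.isSubSemiModClosed.Build R^c M (cyclic_pred m)
    (GRing.submod_closed_semi (cyclic_closed m)).

Definition cyclic_submod m : submodClosed M := cyclic_pred m.

Definition addsm_pred (N1 N2 : submodClosed M) : {pred M} :=
  fun x => `[< exists y z, [/\ y \in N1, z \in N2 & x = y + z] >].

Fact addsm_closed N1 N2 : GRing.submod_closed (addsm_pred N1 N2).
Proof.
split=> [|a u v].
  by apply/asboolP; exists 0, 0; rewrite addr0 !rpred0.
move=> /asboolP[y [z [Ny Nz ->]]] /asboolP[y' [z' [Ny' Nz' ->]]].
apply/asboolP; exists (a *: y + y'), (a *: z + z').
by rewrite !rpredD ?rpredZ // scalerDr addrACA.
Qed.

HB.instance Definition _ N1 N2 :=
  GRing.isSubSemiModClosed.Build R^c M (addsm_pred N1 N2)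
    (GRing.submod_closed_semi (addsm_closed N1 N2)).

Definition addsm N1 N2 : submodClosed M := addsm_pred N1 N2.

Definition nonzero_submod N : Prop := exists2 x, x \in N & x != 0.

Definition dense_submod N : Prop :=
  forall x y : M, x != 0 -> exists2 r : R, r \in residual N y & mulmr x r != 0.

End Submodules.

Arguments whole {R M}.

Definition monoform (R : pzRingType) (M : rmodType R) : Prop :=
  (exists x : M, x != 0) /\
  forall N : submodClosed M, nonzero_submod N -> dense_submod N.

(* ring_quotient only provides the additive group M / N, and submodClosed does
   not record closure under opposite, which Quotient.quot requires. *)
Section QuotientModule.
Variables (R : pzRingType) (M : lmodType R) (N : submodClosed M).

Fact submod_zmod_closed : GRing.zmod_closed (N : {pred M}).
Proof. by split=> [|x y Nx Ny]; rewrite ?rpred0 // rpredD // -scaleN1r rpredZ. Qed.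

Definition submod_zmodClosed : zmodClosed M :=
  HB.pack (N : {pred M})
    (GRing.isZmodClosed.Build M (N : {pred M}) submod_zmod_closed).

Definition quotMod : Type := Quotient.quot submod_zmodClosed.

HB.instance Definition _ := EqQuotient.on quotMod.
HB.instance Definition _ := GRing.Zmodule.on quotMod.
HB.instance Definition _ := ZmodQuotient.on quotMod.

Definition quotMod_scale (a : R) := lift_op1 quotMod ( *:%R a).

Lemma pi_quotMod_scale a : {morph \pi_quotMod : x / a *: x >-> quotMod_scale a x}.
Proof.
move=> x; unlock quotMod_scale; apply/eqP; rewrite piE.
have Nx : x - repr (\pi_quotMod x) \in N.
  by rewrite -[_ \in N]/(_ \in submod_zmodClosed) Quotient.idealrBE reprK.
by rewrite Quotient.equivE -scalerBr -[_ \in _]/(_ \in N) rpredZ.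
Qed.

Canonical pi_quotMod_scale_morph a := PiMorph1 (pi_quotMod_scale a).

Fact quotMod_scalerA a b v :
  quotMod_scale a (quotMod_scale b v) = quotMod_scale (a * b) v.
Proof. by elim/quotW: v => x; rewrite !piE scalerA. Qed.

Fact quotMod_scale1r : left_id 1 quotMod_scale.
Proof. by elim/quotW => x; rewrite !piE scale1r. Qed.

Fact quotMod_scalerDr : right_distributive quotMod_scale +%R.
Proof. by move=> a; elim/quotW => x; elim/quotW => y; rewrite !piE scalerDr. Qed.

Fact quotMod_scalerDl v : {morph quotMod_scale^~ v : a b / a + b}.
Proof. by elim/quotW: v => x a b; rewrite !piE scalerDl. Qed.

HB.instance Definition _ := GRing.Zmodule_isLmodule.Build R quotMod
  quotMod_scalerA quotMod_scale1r quotMod_scalerDr quotMod_scalerDl.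

Lemma quotMod_eq0 x : (\pi_quotMod x == 0) = (x \in N).
Proof. by rewrite piE Quotient.equivE subr0. Qed.

Lemma quotMod_scaleE a x : a *: \pi_quotMod x = \pi_quotMod (a *: x).
Proof. by rewrite [RHS]pi_quotMod_scale. Qed.

End QuotientModule.

Section RightIdealFamilies.
Variable R : pzRingType.
Implicit Types (F : set (rightIdeal R)) (I J P : rightIdeal R) (a : R).

Definition comonoform P : Prop :=
  (exists a : R, a \notin P) /\ monoform (quotMod P).

Definition right_oka F : Prop :=
  F whole /\
  forall I a, F (addsm I (cyclic_submod (a : regmod R))) ->
              F (residual I a) -> F I.

Definition divisible F : Prop := forall a I, F I -> F (residual I a).

Definition semifilter F : Prop :=
  forall I J, F I -> {subset I <= J} -> F J.

Definition chains_bounded F : Prop :=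
  forall C : set (rightIdeal R),
    C !=set0 -> C `<=` F -> total_on C (fun I J => {subset I <= J}) ->
  exists2 U, F U & forall I, C I -> {subset I <= U}.

Definition strict_sub J I : Prop :=
  {subset J <= I} /\ ~ {subset I <= J}.

End RightIdealFamilies.

(* Main.v *)
Require Import Defs.
From HB Require Import structures.
From mathcomp Require Import all_boot all_algebra.
From mathcomp Require Import boolp classical_sets.

Local Open Scope classical_set_scope.

(** Everything reduces to the fact that a right ideal [P] maximal among those
    outside a divisible right Oka family [F] is comonoform.  Granting it, a
    right ideal [I] outside [F] lies, by Zorn's lemma, below such a maximal
    [P]; a semifilter containing [I] also contains [P], so it meets the
    comonoform right ideals outside [F].  Parts (2) and (3) are the cases of
    the semifilters of right ideals (properly) containing [J] and of all right
    ideals.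

    For the maximal [P], the two closure conditions on [F] pull in opposite
    directions.  The Oka property and maximality give [a^-1 P] outside [F]
    whenever [a] is not in [P].  Divisibility and maximality give [b^-1 K] in
    [F] whenever [K] properly contains [P].  If [R/P] were not monoform, there
    would be [I] properly containing [P], some [b], and some [a] outside [P]
    with [b^-1 I] contained in [a^-1 P].  The right ideal
    [K = P + b (a^-1 P)] then satisfies [b^-1 K = a^-1 P], so it is outside
    [F] and must equal [P]; hence [a^-1 P = b^-1 P = b^-1 I], which is in [F]
    because [I] is: a contradiction. *)

Import GRing.Theory.
Local Open Scope ring_scope.
Local Open Scope quotient_scope.

Section MaximalOutside.
Variables (R : pzRingType) (F : set (rightIdeal R)).
Implicit Types (I J K P : rightIdeal R) (a b r : R).

Definition maximal_outside P : Prop :=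
  ~ F P /\ forall I, {subset P <= I} -> ~ F I -> {subset I <= P}.

Lemma exists_maximal_outside I :
  chains_bounded (~` F) -> ~ F I ->
  exists2 P, maximal_outside P & {subset I <= P}.
Proof.
move=> F'_chains F'I.
pose T := {K : rightIdeal R | ~ F K /\ {subset I <= K}}.
have I_in : ~ F I /\ {subset I <= I} by split.
pose le : rel T := fun x y => `[< {subset sval x <= sval y} >].
have [|||t tmax] := @ZL_preorder T (exist _ I I_in) le.
- by move=> x; apply/asboolP.
- move=> x y z /asboolP le_xy /asboolP le_yz.
  by apply/asboolP => u /le_xy /le_yz.
- move=> A A_tot.
  (* The empty chain, outside the scope of [chains_bounded], is bounded by
     [I]. *)
  have [[t0 At0]|A0] := pselect (A !=set0); last first.
    by exists (exist _ I I_in) => s As; case: A0; exists s.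
  have [|||U F'U ubU] := F'_chains [set sval t | t in A].
  + by exists (sval t0), t0.
  + by move=> _ [t _ <-]; exact: (svalP t).1.
  + move=> _ _ [s As <-] [t At <-].
    by have [/asboolP|/asboolP] := A_tot s t As At; [left|right].
  have IU : {subset I <= U}.
    by move=> x /(svalP t0).2; apply: ubU; exists t0.
  by exists (exist _ U (conj F'U IU)) => s As; apply/asboolP/ubU; exists s.
- exists (sval t); last exact: (svalP t).2.
  split=> [|K tK F'K]; first exact: (svalP t).1.
  have IK : {subset I <= K} by move=> x /(svalP t).2 /tK.
  by apply/asboolP/(tmax (exist _ K (conj F'K IK)))/asboolP.
Qed.

Lemma residual_outside P a :
  right_oka F -> maximal_outside P -> a \notin P -> ~ F (residual P a).
Proof.
move=> [_ F_oka] [F'P Pmax] aP FPa; apply: F'P; apply: F_oka FPa.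
apply: contrapT => F'Pa; move: aP; rewrite (Pmax _ _ F'Pa) //.
- move=> x Px; apply/asboolP; exists x, 0.
  by rewrite rpred0 addr0.
- apply/asboolP; exists 0, (a : regmod R); rewrite rpred0 add0r; split=> //.
  by apply/asboolP; exists 1; rewrite /mulmr scale1r.
Qed.

(** Density of [I/P] in [R/P] amounts to this: the [r] with [b r] in [I] do
    not all multiply [a] into [P].  Moving to [K = P + b (a^-1 P)] makes up for
    [F] not being closed under larger right ideals: [F (residual I b)] and the
    inclusion assumed for contradiction do not by themselves give
    [F (residual P a)]. *)
Lemma residual_not_sub P I a b :
  divisible F -> right_oka F -> maximal_outside P ->
  F I -> {subset P <= I} -> a \notin P ->
  ~ {subset residual I b <= residual P a}.
Proof.
move=> F_div F_oka maxP FI PI aP Ib_sub.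
have F'Pa := residual_outside P a F_oka maxP aP.
have [|r x y|K KE] := @submod_of_set _ (regmod R)
    [set x | exists p s, [/\ p \in P, s \in residual P a &
                            x = p + mulmr (b : regmod R) s]].
- by exists 0, 0; rewrite !rpred0 /mulmr scale0r addr0.
- move=> [p [s [Pp Ps ->]]] [q [t [Pq Pt ->]]].
  exists (r *: p + q), (r *: (s : regmod R) + t).
  split; first by rewrite rpredD ?rpredZ.
    by rewrite rpredD ?rpredZ.
  by rewrite /mulmr scalerDr scalerDl scalerA addrACA.
have PK : {subset P <= K}.
  by move=> x Px; apply/KE; exists x, 0; rewrite Px rpred0 /mulmr scale0r addr0.
have Kb : residual K b = residual P a.
  apply: submod_ext => s; apply/idP/idP => [/KE[p [t [Pp Pt E]]]|Ps]; last first.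
    by apply/KE; exists 0, s; rewrite rpred0 add0r.
  (* [s - t] is in [b^-1 P], hence in [b^-1 I] and so in [a^-1 P]. *)
  rewrite -[s](subrK t) rpredD //; apply: Ib_sub; apply: PI.
  have pE : mulmr (b : regmod R) (s - t) = p.
    by rewrite /mulmr scalerBl; apply/eqP; rewrite subr_eq; apply/eqP.
  by rewrite -[_ \in _]/(mulmr (b : regmod R) (s - t) \in P) pE.
have KP : {subset K <= P}.
  by case: maxP => _; apply=> // FK; apply: F'Pa; rewrite -Kb; exact: F_div.
apply: F'Pa; suff -> : residual P a = residual I b by exact: F_div.
apply: submod_ext => s; apply/idP/idP; last exact: Ib_sub.
by rewrite -Kb => /KP /PI.
Qed.

Lemma comonoform_maximal_outside P :
  divisible F -> right_oka F -> maximal_outside P -> comonoform P.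
Proof.
move=> F_div F_oka maxP.
have [a aP] : exists a : R, a \notin P.
  apply: contrapT => /forallNP allP; case: maxP => F'P _; apply: F'P.
  suff -> : P = whole by case: F_oka.
  by apply: submod_ext => x; have /negP/negPn -> := allP x.
split; first by exists a.
split; first by exists (\pi_(quotMod P) a); rewrite quotMod_eq0.
move=> N [+ + +] + y.
elim/quotW=> c Nc; rewrite quotMod_eq0 => cP.
elim/quotW: y => b; elim/quotW=> d; rewrite quotMod_eq0 => dP.
have [||I IE] := @submod_of_set _ (regmod R) [set x | \pi_(quotMod P) x \in N].
- by rewrite /= (_ : \pi 0 = 0) ?rpred0 //; apply/eqP; rewrite quotMod_eq0 rpred0.
- move=> r u v Nu Nv /=.
  have -> : \pi_(quotMod P) (r *: u + v) =
      r *: \pi_(quotMod P) u + \pi_(quotMod P) v.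
    by rewrite quotMod_scaleE; exact: raddfD.
  by rewrite rpredD ?rpredZ.
have PI : {subset P <= I}.
  move=> u Pu; apply/IE; move: Pu.
  by rewrite /= -quotMod_eq0 => /eqP ->; rewrite rpred0.
have FI : F I.
  apply: contrapT => F'I; move: cP; case: maxP => _ Pmax.
  by rewrite (Pmax I PI F'I) //; apply/IE.
apply: contrapT => noR.
apply: (@residual_not_sub P I d b) => // r /IE Ibr.
apply: contrapT => /negP Pdr; apply: noR; exists r.
  by move: Ibr; rewrite /= -quotMod_scaleE.
by rewrite /mulmr quotMod_scaleE quotMod_eq0.
Qed.

End MaximalOutside.

Lemma semifilter_sub_oka (R : pzRingType) (F F0 : set (rightIdeal R)) :
  divisible F -> right_oka F -> chains_bounded (~` F) -> semifilter F0 ->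
  @comonoform R `&` F0 `<=` F -> F0 `<=` F.
Proof.
move=> F_div F_oka F'_chains F0_semi sub I F0I; apply: contrapT => F'I.
have [P maxP IP] := exists_maximal_outside R F I F'_chains F'I.
case: (maxP) => + _; apply; apply: sub; split; last exact: F0_semi IP.
exact: comonoform_maximal_outside maxP.
Qed.

Local Close Scope quotient_scope.
Local Close Scope ring_scope.

Theorem theorem6p11 (R : pzRingType) (F : set (rightIdeal R))
    (F_divisible : divisible F) (F_oka : right_oka F)
    (F'_chains : chains_bounded (~` F)) :
  [/\ forall F0 : set (rightIdeal R), semifilter F0 ->
        (@comonoform R) `&` F0 `<=` F -> F0 `<=` F,
      forall J : rightIdeal R,
        ((forall I : rightIdeal R, comonoform I -> {subset J <= I} -> F I) ->
         forall I : rightIdeal R, {subset J <= I} -> F I) /\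
        ((forall I : rightIdeal R, comonoform I -> strict_sub J I -> F I) ->
         forall I : rightIdeal R, strict_sub J I -> F I)
    & (@comonoform R) `<=` F -> F = setT].
Proof.
have main F0 := @semifilter_sub_oka R F F0 F_divisible F_oka F'_chains.
split=> [//|J|sub].
- split=> sub.
  + apply: (main [set I | {subset J <= I}]) => [I K JI IK x /JI /IK //|].
    by move=> I [mI JI]; exact: sub.
  + apply: (main (strict_sub J)) => [I K [JI IJ] IK|I [mI JI]]; last exact: sub.
    by split=> [x /JI /IK //|KJ]; apply: IJ => x /IK /KJ.
- rewrite -subTset; apply: main => // I [mI _]; exact: sub.
Qed.
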